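(* Let $\lambda$ be a nonzero real number. For every integer $n\ge 0$, $$E_{n,\lambda}=\sum_{k=0}^{n}2^{-k}\sum_{j=0}^{k}(-1)^{j}\binom{k}{j}(2j+1)_{n,\lambda}.$$
   Context: The degenerate falling factorials are $(x)_{0,\lambda}=1$ and $(x)_{n,\lambda}=x(x-\lambda)(x-2\lambda)\cdots(x-(n-1)\lambda)$ for $n\ge 1$. The degenerate exponentials are $e_{\lambda}^{x}(t)=\sum_{n=0}^{\infty}(x)_{n,\lambda}\frac{t^{n}}{n!}$ (that is, $(1+\lambda t)^{x/\lambda}$), with $e_\lambda(t)=e_\lambda^1(t)$; in particular $e_\lambda^{-1}(t)=1/e_\lambda(t)$. The type 2 degenerate Euler numbers $E_{n,\lambda}$ are defined by $\frac{2}{e_{\lambda}(t)+e_{\lambda}^{-1}(t)}=\sum_{n=0}^{\infty}E_{n,\lambda}\frac{t^{n}}{n!}$. *)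

(* Defs.v *)
From HB Require Import structures.
From mathcomp Require Import all_boot all_order all_algebra.
From mathcomp Require Import reals.

Set Implicit Arguments.
Unset Strict Implicit.
Unset Printing Implicit Defensive.

Import Order.TTheory GRing.Theory Num.Theory.
Local Open Scope ring_scope.

(* Generating functions are formal power series in t; the libraries have no
   such type, so a series is its coefficient sequence: f n is the coefficient
   of t^n. *)
Definition fps (R : realType) := nat -> R.

Definition fps_const (R : realType) (c : R) : fps R :=
  fun n => if n is 0 then c else 0.

Definition fps_add (R : realType) (f g : fps R) : fps R :=
  fun n => f n + g n.

Definition fps_mul (R : realType) (f g : fps R) : fps R :=
  fun n => \sum_(i < n.+1) f (n - i)%N * g i.

(* The first n coefficients of 1 / f, obtained by solving f * g = 1 for one
   coefficient of g at a time; meaningful when f 0 != 0. *)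
Fixpoint fps_inv_seq (R : realType) (f : fps R) (n : nat) : seq R :=
  if n is m.+1 then
    let s := fps_inv_seq f m in
    rcons s (((m == 0)%:R - \sum_(i < m) f (m - i)%N * s`_i) / f 0%N)
  else [::].

Definition fps_inv (R : realType) (f : fps R) : fps R :=
  fun n => (fps_inv_seq f n.+1)`_n.

Definition fps_div (R : realType) (f g : fps R) : fps R :=
  fps_mul f (fps_inv g).

(* The series \sum_n a_n t^n / n!. *)
Definition egf (R : realType) (a : nat -> R) : fps R :=
  fun n => a n / n`!%:R.

(* (x)_{n,lambda} *)
Definition degen_ffact (R : realType) (lambda x : R) (n : nat) : R :=
  \prod_(i < n) (x - i%:R * lambda).

(* e_lambda^x(t) *)
Definition degen_exp (R : realType) (lambda x : R) : fps R :=
  egf (degen_ffact lambda x).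

(* E_{n,lambda}: n! times the coefficient of t^n in
   2 / (e_lambda(t) + e_lambda^{-1}(t)). *)
Definition type2_degen_euler (R : realType) (lambda : R) (n : nat) : R :=
  n`!%:R *
  fps_div (fps_const 2)
          (fps_add (degen_exp lambda 1) (degen_exp lambda (- 1))) n.

Lemma size_fps_inv_seq (R : realType) (f : fps R) n :
  size (fps_inv_seq f n) = n.
Proof. by elim: n => //= n IHn; rewrite size_rcons IHn. Qed.

Lemma nth_fps_inv_seq (R : realType) (f : fps R) n i :
  (i < n)%N -> (fps_inv_seq f n)`_i = fps_inv f i.
Proof.
elim: n => // n IHn; rewrite ltnS leq_eqVlt => /orP[/eqP-> //|lt_in].
by rewrite /= nth_rcons size_fps_inv_seq lt_in IHn.
Qed.

Lemma fps_mulfV (R : realType) (f : fps R) :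
  f 0%N != 0 -> fps_mul f (fps_inv f) =1 fps_const 1.
Proof.
move=> f0 n; rewrite /fps_mul big_ord_recr /= subnn.
rewrite {2}/fps_inv /= nth_rcons size_fps_inv_seq ltnn eqxx.
under [in X in _ + X]eq_bigr => i _ do rewrite nth_fps_inv_seq //.
by rewrite mulrCA divff // mulr1 addrC subrK; case: n.
Qed.

Lemma fps_mulf_div_const (R : realType) (c : R) (f : fps R) :
  f 0%N != 0 -> fps_mul f (fps_div (fps_const c) f) =1 fps_const c.
Proof.
move=> f0 n.
have divE m : fps_div (fps_const c) f m = c * fps_inv f m.
  rewrite /fps_div /fps_mul big_ord_recr /= subnn big1 ?add0r // => i _.
  by rewrite -(subnSK (ltn_ord i)) mul0r.
have -> : fps_mul f (fps_div (fps_const c) f) n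
          = c * fps_mul f (fps_inv f) n.
  by rewrite /fps_mul mulr_sumr; apply: eq_bigr => i _; rewrite divE mulrCA.
by rewrite fps_mulfV //; case: n => [|n] /=; rewrite ?mulr1 ?mulr0.
Qed.

Lemma type2_degen_euler_egf (R : realType) (lambda : R) :
  egf (type2_degen_euler lambda) =1
  fps_div (fps_const 2)
          (fps_add (degen_exp lambda 1) (degen_exp lambda (- 1))).
Proof.
move=> n; rewrite /egf /type2_degen_euler mulrAC divff ?mul1r //.
by rewrite pnatr_eq0 -lt0n fact_gt0.
Qed.

(* The denominator has constant coefficient 2, so the division is genuine. *)
Lemma type2_degen_euler_mul (R : realType) (lambda : R) :
  fps_mul (fps_add (degen_exp lambda 1) (degen_exp lambda (- 1)))
          (egf (type2_degen_euler lambda)) =1 fps_const 2.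
Proof.
move=> n; have d0 : fps_add (degen_exp lambda 1) (degen_exp lambda (- 1)) 0%N
                    != 0.
  by rewrite /fps_add /degen_exp /egf /degen_ffact !big_ord0 fact0 divr1 (pnatr_eq0 R 2).
rewrite -(fps_mulf_div_const 2 d0); apply: eq_bigr => i _.
by rewrite type2_degen_euler_egf.
Qed.

(* Main.v *)
Require Import Defs.
From HB Require Import structures.
From mathcomp Require Import all_boot all_order all_algebra.
From mathcomp Require Import reals.
From mathcomp Require Import ring.

Import Order.TTheory GRing.Theory Num.Theory.
Local Open Scope ring_scope.

Set Implicit Arguments.
Unset Strict Implicit.

(** Write e^x for the series e_lambda^x(t).  Since e^x e^y = e^(x + y)
    ([degen_exp_mul]),

      2 / (e + e^(-1)) = e / (1 - (1 - e^2) / 2)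
                       = \sum_k 2^(-k) (1 - e^2)^k e,

    and the binomial expansion of (1 - e^2)^k e is
    \sum_j (-1)^j C(k, j) e^(2 j + 1), that is, the k-th alternating difference
    with step 2 of x |-> e^x at x = 1.  As 1 - e^2 has no constant term,
    (1 - e^2)^k contributes to the coefficient of t^n only for k <= n
    ([alt_diff_degen_exp_eq0]), whence the finite sum of the theorem.

    The geometric series is never summed as an infinite object: the sum up to
    k = n is multiplied by e + e^(-1), where it telescopes to 2 minus a multiple
    of the difference of order n + 1, whose n-th coefficient is zero.  The
    quotient is then identified by cancelling the invertible series
    e + e^(-1) ([fps_mulfI]). *)

(** A series with nonzero constant term can be cancelled: the n-th coefficient
    of the product determines that of the second factor from the earlier
    ones. *)
Lemma fps_mulfI (R : realType) (f g h : fps R) :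
  f 0%N != 0 -> fps_mul f g =1 fps_mul f h -> g =1 h.
Proof.
move=> f0 fgh n; elim/ltn_ind: n => n IHn; move: (fgh n).
rewrite /fps_mul !big_ord_recr /= subnn.
under eq_bigr => i _ do rewrite IHn //.
by move/addrI/(mulfI f0).
Qed.

Lemma degen_exp_coef0 (R : realType) (lambda x : R) :
  degen_exp lambda x 0%N = 1.
Proof. by rewrite /degen_exp /egf /degen_ffact big_ord0 fact0 divr1. Qed.

(** The coefficientwise form of the differential equation
    (1 + lambda t) F' = x F satisfied by F = e_lambda^x(t). *)
Lemma degen_exp_coefS (R : realType) (lambda x : R) (n : nat) :
  n.+1%:R * degen_exp lambda x n.+1
  = (x - n%:R * lambda) * degen_exp lambda x n.
Proof.
rewrite /degen_exp /egf /degen_ffact big_ord_recr /= factS natrM.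
have n1 : n.+1%:R != 0 :> R by rewrite pnatr_eq0.
have nf : n`!%:R != 0 :> R by rewrite pnatr_eq0 -lt0n fact_gt0.
move: n1 nf; move: n.+1%:R n`!%:R => a b a0 b0; field; exact/andP.
Qed.

Lemma degen_exp_0 (R : realType) (lambda : R) :
  degen_exp lambda 0 =1 fps_const 1.
Proof.
case=> [|n]; first exact: degen_exp_coef0.
by rewrite /degen_exp /egf /degen_ffact big_ord_recl /= mul0r subrr !mul0r.
Qed.

(** Both sides have constant term 1 and, by the Leibniz rule, satisfy
    (1 + lambda t) F' = (x + y) F. *)
Lemma degen_exp_mul (R : realType) (lambda x y : R) :
  fps_mul (degen_exp lambda x) (degen_exp lambda y)
  =1 degen_exp lambda (x + y).
Proof.
elim=> [|n IHn].
  by rewrite /fps_mul big_ord1 !degen_exp_coef0 mulr1.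
have n1 : n.+1%:R != 0 :> R by rewrite pnatr_eq0.
apply: (mulfI n1); rewrite degen_exp_coefS -IHn /fps_mul !mulr_sumr.
(* Leibniz rule: distribute n + 1 = (n + 1 - i) + i over the two factors. *)
transitivity (\sum_(i < n.+2)
   ((n.+1 - i)%:R * degen_exp lambda x (n.+1 - i)%N * degen_exp lambda y i
    + degen_exp lambda x (n.+1 - i)%N * (i%:R * degen_exp lambda y i))).
  apply: eq_bigr => i _; have le_in : (i <= n.+1)%N by rewrite -ltnS.
  have -> : n.+1%:R = (n.+1 - i)%:R + i%:R :> R by rewrite -natrD subnK.
  ring.
rewrite big_split /= big_ord_recr /= subnn !mul0r addr0.
rewrite [X in _ + X]big_ord_recl /= mul0r mulr0 add0r -big_split /=.
apply: eq_bigr => i _; have le_in : (i <= n)%N by rewrite -ltnS.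
rewrite /bump /= add1n subSS subSn // !degen_exp_coefS natrB //.
ring.
Qed.

(** The alternating form (1 - T)^k of the k-th difference, where T is the
    translation by h; it equals (-1)^k times the forward difference. *)
Definition alt_diff (R : realType) (h : R) (k : nat) (f : R -> R) (x : R) : R :=
  \sum_(j < k.+1) (-1) ^+ j * 'C(k, j)%:R * f (x + j%:R * h).

Lemma alt_diff0 (R : realType) (h : R) (f : R -> R) (x : R) :
  alt_diff h 0 f x = f x.
Proof. by rewrite /alt_diff big_ord1 bin0 !mul1r mul0r addr0. Qed.

(** Pascal's rule. *)
Lemma alt_diffS (R : realType) (h : R) (k : nat) (f : R -> R) (x : R) :
  alt_diff h k.+1 f x = alt_diff h k f x - alt_diff h k f (x + h).
Proof.
rewrite /alt_diff big_ord_recl /= !bin0.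
under eq_bigr => i _ do
  rewrite /bump /= add1n binS natrD mulrDr mulrDl.
rewrite big_split /= addrA; congr (_ + _).
  rewrite big_ord_recr /= bin_small // mulr0 mul0r addr0.
  by rewrite [RHS]big_ord_recl /= bin0.
rewrite -sumrN; apply: eq_bigr => i _.
have -> : x + h + i%:R * h = x + i.+1%:R * h by rewrite -natr1; ring.
by rewrite exprS; ring.
Qed.

(** Multiplication by e_lambda^y(t) commutes with differences in the exponent,
    because it translates the exponent. *)
Lemma fps_mul_alt_diff (R : realType) (lambda h x y : R) (k : nat) :
  fps_mul (degen_exp lambda y)
          (fun n => alt_diff h k (fun z => degen_exp lambda z n) x)
  =1 fun n => alt_diff h k (fun z => degen_exp lambda z n) (x + y).
Proof.
move=> n; rewrite /fps_mul /alt_diff.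
under eq_bigr => i _ do rewrite mulr_sumr.
rewrite exchange_big /=; apply: eq_bigr => j _.
have -> : x + y + j%:R * h = y + (x + j%:R * h) by ring.
rewrite -degen_exp_mul /fps_mul mulr_sumr.
by apply: eq_bigr => i _; rewrite mulrCA.
Qed.

(** The difference of order k is e^x (1 - e^h)^k, and 1 - e^h has no constant
    term. *)
Lemma alt_diff_degen_exp_eq0 (R : realType) (lambda h x : R) (k n : nat) :
  (n < k)%N -> alt_diff h k (fun z => degen_exp lambda z n) x = 0.
Proof.
elim: k n => // k IHk n; rewrite ltnS => le_nk.
rewrite alt_diffS -(fps_mul_alt_diff _ _ _ _ _ n) /fps_mul big_ord_recr /=.
rewrite subnn degen_exp_coef0 mul1r big1 ?add0r ?subrr // => i _.
by rewrite IHk ?mulr0 // (leq_trans (ltn_ord i)).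
Qed.

(** The k-th summand of the product is 2^(-k) times
    (e^2 + 1) (1 - e^2)^k = 2 (1 - e^2)^k - (1 - e^2)^(k + 1), which
    telescopes. *)
Lemma fps_mul_alt_diff_sum (R : realType) (lambda : R) :
  fps_mul (fps_add (degen_exp lambda 1) (degen_exp lambda (- 1)))
    (fun n => \sum_(k < n.+1)
                2 ^- k * alt_diff 2 k (fun z => degen_exp lambda z n) 1)
  =1 fps_const 2.
Proof.
move=> n; set D := fun k x => alt_diff 2 k (fun z => degen_exp lambda z n) x.
(* The summands with i < k vanish, so that k can run up to n in every
   coefficient and the two sums can be exchanged. *)
transitivity (\sum_(k < n.+1) 2 ^- k * (D k (1 + 1) + D k (1 + (- 1)))).
  under [RHS]eq_bigr => k _ do
    rewrite /D -!(fps_mul_alt_diff _ _ _ _ _ n) /fps_mul -big_split mulr_sumr.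
  rewrite exchange_big /=; apply: eq_bigr => i _.
  rewrite (big_ord_widen n.+1 (fun k => 2 ^- k *
    alt_diff 2 k (fun z => degen_exp lambda z i) 1)) // big_mkcond mulr_sumr.
  apply: eq_bigr => k _; case: ltnP => [_|lt_ik].
    by rewrite /fps_add; ring.
  by rewrite (alt_diff_degen_exp_eq0 _ _ _ lt_ik) !mulr0 addr0 mulr0.
have step k : 2 ^- k * (D k (1 + 1) + D k (1 + (- 1)))
              = 2 * (2 ^- k * D k 0 - 2 ^- k.+1 * D k.+1 0).
  have nz2 : 2 ^+ k != 0 :> R by rewrite expf_neq0 // pnatr_eq0.
  rewrite subrr /D alt_diffS add0r exprS; field.
  exact: nz2.
under eq_bigr => k _ do rewrite step.
rewrite -mulr_sumr -(big_mkord xpredT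
  (fun k => 2 ^- k * D k 0 - 2 ^- k.+1 * D k.+1 0)).
under eq_bigr => k _ do rewrite -opprB.
rewrite sumrN telescope_sumr // opprB /D (alt_diff_degen_exp_eq0 _ _ _ (ltnSn n)).
rewrite mulr0 subr0 expr0 invr1 mul1r alt_diff0 degen_exp_0.
by case: n {D step} => [|n] /=; rewrite ?mulr1 ?mulr0.
Qed.

Theorem theorem2p10 (R : realType) (lambda : R) (hlambda : lambda != 0)
    (n : nat) :
  type2_degen_euler lambda n =
  \sum_(k < n.+1) 2 ^- k *
    \sum_(j < k.+1)
      (-1) ^+ j * 'C(k, j)%:R * degen_ffact lambda (2 * j + 1)%N%:R n.
Proof.
have nf : n`!%:R != 0 :> R by rewrite pnatr_eq0 -lt0n fact_gt0.
have d0 : fps_add (degen_exp lambda 1) (degen_exp lambda (- 1)) 0%N != 0.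
  by rewrite /fps_add !degen_exp_coef0 -(natrD R 1 1) pnatr_eq0.
have := fps_mulfI d0 (fun m => etrans (type2_degen_euler_mul lambda m)
  (esym (fps_mul_alt_diff_sum lambda m))) n.
rewrite /egf => /(canRL (divfK nf)) ->; rewrite mulr_suml.
apply: eq_bigr => k _; rewrite -mulrA; congr (_ * _).
rewrite /alt_diff mulr_suml; apply: eq_bigr => j _.
have -> : 1 + j%:R * 2 = (2 * j + 1)%N%:R :> R by rewrite natrD natrM; ring.
by rewrite /degen_exp /egf -[LHS]mulrA divfK.
Qed.
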